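(* Let $R$ be a principal ideal domain with field of fractions $F$, let $n\geq 2$, let $a_1,\dots,a_n\in R$ satisfy $Ra_1+\cdots+Ra_n=R$ with $a_1\neq 0$, and let $S=\{(x_1,\dots,x_n)\in R^n : a_1x_1+\cdots+a_nx_n=0\}$. Suppose $1<m\leq n$ and $Ra_1+\cdots+Ra_m=R$. Then one can construct (in particular, there exist) matrices $X\in M_{m-1}(R)$, $Y\in M_{m-1,n-m}(R)$ and $$A=\begin{pmatrix} X & Y\\ 0 & I\end{pmatrix}\in M_{n-1}(R),$$ where $I$ is the identity matrix of size $n-m$, such that $X$ is upper triangular with diagonal entries $$\frac{a_1}{(a_1,a_2)},\ \frac{(a_1,a_2)}{(a_1,a_2,a_3)},\ \dots,\ \frac{(a_1,\dots,a_{m-2})}{(a_1,\dots,a_{m-1})},\ (a_1,\dots,a_{m-1}),$$ and the columns of $A$ are the coordinates, relative to $w(1,2),\dots,w(1,n)$, of a basis $z_2,\dots,z_n$ of the $R$-module $S$.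
   Context: $(r_1,\dots,r_t)$ denotes a (fixed choice of) greatest common divisor of $r_1,\dots,r_t\in R$, with the choices $(a_1)=a_1$ and $(a_1,\dots,a_m)=1$; thus the $i$th diagonal entry of $X$ is $(a_1,\dots,a_i)/(a_1,\dots,a_{i+1})$ for $1\leq i\leq m-1$ (when $m=2$, the single entry is $a_1$). For $2\leq j\leq n$, $w(1,j)\in F^n$ is the vector with first entry $-a_j/a_1$, $j$th entry $1$, and all other entries $0$; these vectors form an $F$-basis of the space of solutions in $F^n$ of $a_1X_1+\cdots+a_nX_n=0$. *)

(* Defs.v *)
From HB Require Import structures.
From mathcomp Require Import all_boot all_order all_algebra.

Set Implicit Arguments.
Unset Strict Implicit.
Unset Printing Implicit Defensive.

Import GRing.Theory.
Local Open Scope ring_scope.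

Notation "x %:F" := (@FracField.tofrac _ x) : ring_scope.

(* Ideals are Prop-valued so that they need not be decidable; the unit ideal
   is allowed, unlike in idealr_closed of ring_quotient. *)
Definition is_ideal (R : comNzRingType) (I : R -> Prop) : Prop :=
  [/\ I 0, forall x y, I x -> I y -> I (x + y) & forall r x, I x -> I (r * x)].

Definition is_PID (R : idomainType) : Prop :=
  forall I : R -> Prop, is_ideal I ->
    exists g : R, forall x, I x <-> exists r, x = r * g.

Definition divides (R : comNzRingType) (d x : R) : Prop := exists c, x = c * d.

Definition is_prefix_gcd (R : comNzRingType) (n : nat) (a : 'I_n -> R)
    (t : nat) (d : R) : Prop :=
  (forall j : 'I_n, (j < t)%N -> divides d (a j)) /\
  (forall e : R, (forall j : 'I_n, (j < t)%N -> divides e (a j)) ->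
     divides e d).

Definition solution (R : comNzRingType) (n : nat) (a : 'I_n -> R)
    (x : 'cV[R]_n) : Prop :=
  \sum_(i < n) a i * x i 0 = 0.

Definition is_basis (R : comNzRingType) (V : lmodType R) (S : V -> Prop)
    (p : nat) (z : 'I_p -> V) : Prop :=
  [/\ forall j, S (z j),
      forall c : 'I_p -> R, \sum_(j < p) c j *: z j = 0 -> forall j, c j = 0
    & forall x, S x -> exists c : 'I_p -> R, x = \sum_(j < p) c j *: z j].

(* With 1-based numbering of a, w a j is the vector w(1, j + 2). *)
Definition w (R : idomainType) (p : nat) (a : 'I_p.+1 -> R) (j : 'I_p) :
    'cV[{fraction R}]_p.+1 :=
  \col_(i < p.+1) if i == ord0 then - (a (lift ord0 j))%:F / (a ord0)%:F
                  else if i == lift ord0 j then 1 else 0.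

(* Main.v *)
Require Import Defs.
From mathcomp Require Import all_boot all_order all_algebra.
From mathcomp Require Import ring.

(* Put d_t = (a_1, ..., a_t).  The last nonzero coordinate of a solution
   supported on the first j coordinates is always a multiple of
   q_j = d_(j-1) / d_j: both d_(j-1) x_j and a_j x_j are multiples of d_(j-1),
   hence so is d_j x_j by Bezout.  The value q_j is attained, since q_j a_j is
   a multiple of d_(j-1), hence a combination of a_1, ..., a_(j-1).  Solutions
   z_j attaining q_j therefore form a triangular basis.  Beyond m one has
   q_j = 1, and z_j can be taken supported on 1, ..., m and j. *)

Set Implicit Arguments.
Unset Strict Implicit.
Unset Printing Implicit Defensive.

Import GRing.Theory.
Local Open Scope ring_scope.

Lemma divides_sum (R : comNzRingType) (I : finType) (P : pred I) (F : I -> R)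
    (g : R) :
  (forall i, P i -> divides g (F i)) -> divides g (\sum_(i | P i) F i).
Proof.
move=> gF; apply: (big_ind (divides g)) => //; first by exists 0; rewrite mul0r.
by move=> x y [b ->] [c ->]; exists (b + c); rewrite mulrDl.
Qed.

Lemma divides_mull (R : comNzRingType) (g b x : R) :
  divides g x -> divides g (b * x).
Proof. by case=> c ->; exists (b * c); rewrite mulrA. Qed.

(** The combinations of the first [t] entries form an ideal. Its generator [g] is a common divisor
    of these entries, so it divides [d], which puts [d] in the ideal. *)
Lemma prefix_gcd_bezout (R : idomainType) (hR : is_PID R) (n : nat)
    (a : 'I_n -> R) (t : nat) (d : R) :
  is_prefix_gcd a t d ->
  exists c : 'I_n -> R, d = \sum_(i < n | (i < t)%N) c i * a i.
Proof.
case=> _ dmax.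
pose I x := exists c : 'I_n -> R, x = \sum_(i < n | (i < t)%N) c i * a i.
have idI : is_ideal I.
  split.
  - by exists (fun=> 0); rewrite big1 // => i _; rewrite mul0r.
  - move=> x y [b ->] [c ->]; exists (fun i => b i + c i).
    by rewrite -big_split; apply: eq_bigr => i _; rewrite mulrDl.
  - move=> r x [c ->]; exists (fun i => r * c i).
    by rewrite mulr_sumr; apply: eq_bigr => i _; rewrite mulrA.
have [g gP] := hR I idI.
have [|r ->] := dmax g.
  move=> j jt; apply/gP; exists (fun i => (i == j)%:R).
  rewrite (bigD1 j) //= eqxx mul1r big1 ?addr0 // => i /andP[_ /negPf->].
  by rewrite mul0r.
case: idI => _ _; apply; apply/gP.
by exists 1; rewrite mul1r.
Qed.

(** The witness has [q] at [j] and [- c i] at each [i] below [t]; the bound [t <= j] keeps these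
    positions apart. *)
Lemma solution_with_coordinate (R : comNzRingType) (n : nat) (a : 'I_n -> R)
    (j : 'I_n) (t : nat) (q : R) (c : 'I_n -> R) :
  (t <= j)%N -> q * a j = \sum_(i < n | (i < t)%N) c i * a i ->
  exists z : 'cV[R]_n,
    [/\ solution a z, z j 0 = q
      & forall i : 'I_n, (t <= i)%N -> i != j -> z i 0 = 0].
Proof.
move=> tj qc.
exists (\col_i if i == j then q else if (i < t)%N then - c i else 0); split.
- rewrite /solution (bigD1 j) //= mxE eqxx mulrC qc.
  rewrite [X in _ + X](bigID (fun i : 'I_n => (i < t)%N)) /=.
  rewrite [X in _ + (_ + X)]big1 => [|i].
    rewrite addr0 [X in _ + X](eq_bigl (fun i : 'I_n => (i < t)%N)) => [|i].
      rewrite -big_split big1 //= => i it; rewrite mxE it ifN.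
        by rewrite mulrN mulrC subrr.
      by apply: contraTneq it => ->; rewrite -leqNgt.
    by rewrite andb_idl // => it; apply: contraTneq it => ->; rewrite -leqNgt.
  by case/andP=> /negPf ij /negPf it; rewrite mxE ij it mulr0.
- by rewrite mxE eqxx.
- by move=> i ti /negPf ij; rewrite mxE ij ltnNge ti.
Qed.

Lemma solutionBZ (R : comNzRingType) (n : nat) (a : 'I_n -> R) (b : R)
    (x y : 'cV[R]_n) :
  solution a x -> solution a y -> solution a (x - b *: y).
Proof.
rewrite /solution => ax ay.
transitivity (\sum_i a i * x i 0 - b * \sum_i a i * y i 0).
  by rewrite mulr_sumr -sumrB; apply: eq_bigr => i _; rewrite !mxE; ring.
by rewrite ax ay mulr0 subr0.
Qed.

(** Row [lift ord0 j] holds the pivot of [z j]. The divisibility hypothesis lets a multiple of [z j]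
    clear the last possibly nonzero entry of a solution, as in division by a leading coefficient. *)
Lemma triangular_basis (R : idomainType) (p : nat) (a : 'I_p.+1 -> R)
    (z : 'I_p -> 'cV[R]_p.+1) :
  a ord0 != 0 ->
  (forall j, solution a (z j)) ->
  (forall j, z j (lift ord0 j) 0 != 0) ->
  (forall (j : 'I_p) (i : 'I_p.+1), (j.+1 < i)%N -> z j i 0 = 0) ->
  (forall (j : 'I_p) x, solution a x ->
     (forall i : 'I_p.+1, (j.+1 < i)%N -> x i 0 = 0) ->
     divides (z j (lift ord0 j) 0) (x (lift ord0 j) 0)) ->
  is_basis (solution a) z.
Proof.
move=> a0 az zj0 ztri zdiv; split=> // [c c0 j | x ax].
  (* Coefficients vanish from the last column backwards: in the pivot row of [j], earlier columns
     are zero and later ones already have coefficient zero. *)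
  have [s] := ubnP (p - j)%N; elim: s j => // s IHs j js.
  have := congr1 (fun v : 'cV_p.+1 => v (lift ord0 j) 0) c0.
  rewrite summxE (bigD1 j) //= big1 => [|i ij].
    by rewrite !mxE addr0 => /eqP; rewrite mulf_eq0 (negPf (zj0 j)) orbF => /eqP.
  rewrite mxE; case: (ltngtP i j) ij => [ij _|ij _|/val_inj->]; last by rewrite eqxx.
    by rewrite ztri ?mulr0.
  rewrite IHs ?mul0r //; apply: leq_trans (ltn_sub2l _ ij) js.
  exact: ltn_ord.
suff span m (y : 'cV_p.+1) : (m <= p)%N -> solution a y ->
    (forall i : 'I_p.+1, (m < i)%N -> y i 0 = 0) ->
    exists c : 'I_p -> R, y = \sum_(j < p) c j *: z j.
  by apply: (span p) => // i; rewrite ltnNge -ltnS ltn_ord.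
(* When [m] is 0 only the first entry of [y] can survive, and the equation with [a ord0 != 0] kills
   it. *)
elim: m y => [|m IHm] y mp ay y0.
  exists (fun=> 0); rewrite big1 => [|j _]; last by rewrite scale0r.
  apply/matrixP=> i j; rewrite ord1 mxE.
  have [i0|] := posnP i; last exact: y0.
  move: ay; rewrite /solution big_ord_recl big1 => [|h _]; last first.
    by rewrite y0 ?mulr0.
  move/eqP; rewrite addr0 mulf_eq0 (negPf a0) => /eqP <-.
  by congr (y _ _); apply: val_inj.
pose j := Ordinal mp.
have [b yb] := zdiv j y ay y0.
have [|||c yc] := IHm (y - b *: z j).
- exact: ltnW.
- exact: solutionBZ.
- move=> i; rewrite leq_eqVlt => /predU1P[mi|mi]; rewrite !mxE.
    have -> : i = lift ord0 j by apply: ord_inj; rewrite lift0.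
    by rewrite yb subrr.
  by rewrite y0 // ztri // mulr0 subr0.
exists (fun i => c i + (i == j)%:R * b).
under eq_bigr do rewrite scalerDl; rewrite big_split /= -yc.
rewrite (bigD1 j) //= eqxx mul1r big1 ?addr0 ?subrK // => i /negPf->.
by rewrite mul0r scale0r.
Qed.

Lemma solution_coordinates (R : idomainType) (p : nat) (a : 'I_p.+1 -> R)
    (x : 'cV[R]_p.+1) :
  a ord0 != 0 -> solution a x ->
  map_mx (@FracField.tofrac R) x
    = \sum_(i < p) (x (lift ord0 i) 0)%:F *: w a i.
Proof.
move=> a0 ax; apply/matrixP=> i s; rewrite ord1 mxE summxE.
have a0F : (a ord0)%:F != 0 by rewrite tofrac_eq0.
case: (unliftP ord0 i) => [j|] -> {i s}.
  rewrite (bigD1 j) //= big1 => [|i ij]; rewrite !mxE lift_eqF.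
    by rewrite eqxx mulr1 addr0.
  by rewrite (inj_eq lift_inj) eq_sym (negPf ij) mulr0.
(* Multiplied by [a ord0], the remaining first row is the equation satisfied by [x]. *)
apply: (mulfI a0F); rewrite mulr_sumr.
under eq_bigr do rewrite !mxE eqxx.
move: ax; rewrite /solution big_ord_recl => /eqP; rewrite addr_eq0 => /eqP ax.
rewrite -tofracM ax tofracN rmorph_sum -sumrN.
by apply: eq_bigr => i _; rewrite rmorphM /=; field.
Qed.

(* m = k + 1 and n = k + l + 1, so n - m = l and n - 1 = k + l; the bounds
   1 < m <= n (hence n >= 2) amount to 0 < k.  The 0-based a i is a_(i + 1), and
   d t is the chosen greatest common divisor (a_1, ..., a_t). *)
Theorem theorem4p5 (R : idomainType) (hR : is_PID R)
    (k l : nat) (hk : (0 < k)%N)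
    (a : 'I_(k + l).+1 -> R) (ha0 : a ord0 != 0)
    (han : forall r : R, exists c : 'I_(k + l).+1 -> R,
       r = \sum_i c i * a i)
    (ham : forall r : R, exists c : 'I_(k + l).+1 -> R,
       r = \sum_(i < (k + l).+1 | (i < k.+1)%N) c i * a i)
    (d : nat -> R)
    (hd : forall t : nat, (1 <= t <= k.+1)%N -> is_prefix_gcd a t (d t))
    (hd1 : d 1%N = a ord0) (hdm : d k.+1 = 1) :
  exists (X : 'M[R]_k) (Y : 'M[R]_(k, l)) (A : 'M[R]_(k + l))
         (z : 'I_(k + l) -> 'cV[R]_(k + l).+1),
    [/\ A = block_mx X Y 0 1%:M,
        forall i j : 'I_k, (j < i)%N -> X i j = 0,
        forall i : 'I_k, (X i i)%:F = (d i.+1)%:F / (d i.+2)%:F,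
        forall j : 'I_(k + l),
          map_mx (@FracField.tofrac R) (z j)
            = \sum_(i < k + l) (A i j)%:F *: w a i
      & is_basis (solution a) z].
Proof.
(* Past m the sequence of gcds is constantly 1, with Bezout coefficients
   supported on the first m indices. *)
pose e t := d (minn t k.+1).
have e_bezout t : (0 < t)%N -> exists c : 'I_(k + l).+1 -> R,
    e t = \sum_(i < (k + l).+1 | (i < minn t k.+1)%N) c i * a i.
  move=> t0; apply: (prefix_gcd_bezout hR); apply: hd.
  by rewrite leq_min t0 geq_minr.
have e_div t (i : 'I_(k + l).+1) : (i < t)%N -> divides (e t) (a i).
  move=> it; rewrite /e; case: (leqP t k.+1) => tk.
    by case: (hd t) => [|+ _]; [rewrite tk (leq_trans _ it) | exact].
  by rewrite hdm; exists (a i); rewrite mulr1.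
have e_neq0 t : (0 < t)%N -> e t != 0.
  move=> t0; have [c] := e_div t ord0 t0.
  by apply: contra_eq_neq => ->; rewrite mulr0.
(* [e j.+1] is a combination of entries that [e j.+2] divides. As [j] counts from 0, this quotient
   has index [j + 2] in 1-based numbering. *)
have ratio (j : 'I_(k + l)) : exists q, e j.+1 = q * e j.+2.
  have [//|c ->] := e_bezout j.+1; apply: divides_sum => i.
  rewrite leq_min => /andP[ij _]; apply/divides_mull/e_div.
  exact: ltnW.
have [q qP] := fin_all_exists ratio.
have q_neq0 (j : 'I_(k + l)) : q j != 0.
  have := e_neq0 j.+1 isT; rewrite qP.
  by apply: contraNneq => ->; rewrite mul0r.
(* The cap at [k.+1] lets one family yield both the triangular block and the identity block. *)
have z_ex (j : 'I_(k + l)) : exists z : 'cV[R]_(k + l).+1,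
    [/\ solution a z, z (lift ord0 j) 0 = q j
      & forall i : 'I_(k + l).+1, (minn j.+1 k.+1 <= i)%N ->
          i != lift ord0 j -> z i 0 = 0].
  have [//|c ec] := e_bezout j.+1.
  have [|r ar] := e_div j.+2 (lift ord0 j); first by rewrite lift0.
  (* From [a (lift ord0 j) = r * e j.+2] one gets [q j * a (lift ord0 j) = r * e j.+1], so the
     Bezout coefficients of [e j.+1] are scaled by [r]. *)
  apply: (solution_with_coordinate (c := fun i => r * c i)).
    by rewrite lift0 geq_minl.
  under eq_bigr do rewrite -mulrA.
  by rewrite -mulr_sumr -ec qP ar; ring.
have [z zP] := fin_all_exists z_ex.
have az (j : 'I_(k + l)) : solution a (z j) by case: (zP j).
have zq (j : 'I_(k + l)) : z j (lift ord0 j) 0 = q j by case: (zP j).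
have z0 (j : 'I_(k + l)) (i : 'I_(k + l).+1) :
    (minn j.+1 k.+1 <= i)%N -> i != lift ord0 j -> z j i 0 = 0.
  by case: (zP j) => _ _; apply.
have ztri (j : 'I_(k + l)) (i : 'I_(k + l).+1) : (j.+1 < i)%N -> z j i 0 = 0.
  move=> ji; apply: z0; first by rewrite geq_min ltnW.
  by apply: contraTneq ji => ->; rewrite lift0 ltnn.
pose A := \matrix_(i, j) z j (lift ord0 i) 0.
exists (ulsubmx A), (ursubmx A), A, z; split.
- rewrite -[LHS]submxK; congr block_mx; apply/matrixP=> i j; rewrite !mxE.
    rewrite ztri // lift0 /= ltnS.
    exact: leq_trans (ltn_ord j) (leq_addr _ _).
  (* Lower right block: on the diagonal both gcds are capped to [d k.+1], so their quotient is 1;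
     off it, the row lies beyond the capped support. *)
  have [<-|ij] := eqVneq i j.
    rewrite zq; apply: (mulIf (e_neq0 (rshift k i).+2 isT)).
    have ki : (k < (k + i).+1)%N by rewrite ltnS leq_addr.
    by rewrite -qP mul1r /e /= !(minn_idPr _) // ltnW.
  apply: z0; first by rewrite lift0 geq_min /= !ltnS leq_addr orbT.
  by rewrite (inj_eq lift_inj) (inj_eq (@rshift_inj _ _)).
- by move=> i j ji; rewrite !mxE ztri // lift0.
- move=> i; rewrite !mxE zq.
  (* Here [i.+2 <= k.+1], so [e] agrees with [d] at both indices. *)
  have := qP (lshift l i); have := e_neq0 i.+2 isT.
  rewrite /e /= !(minn_idPl _) ?ltnS ?(ltnW (ltn_ord i)) // => di -> .
  by rewrite tofracM mulfK // tofrac_eq0.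
- move=> j; rewrite (solution_coordinates ha0 (az j)).
  by apply: eq_bigr => i _; rewrite mxE.
apply: triangular_basis => // [j|j x ax x0]; rewrite zq //.
(* Since [e j.+1 = q j * e j.+2], cancelling the nonzero [e j.+2] leaves divisibility by [q j]. *)
suff [b eb] : divides (e j.+1) (e j.+2 * x (lift ord0 j) 0).
  exists b; apply: (mulfI (e_neq0 j.+2 isT)).
  by rewrite eb qP; ring.
have [//|c ->] := e_bezout j.+2; rewrite mulr_suml; apply: divides_sum => i.
rewrite leq_min => /andP[ij _]; rewrite -mulrA; apply: divides_mull.
(* For [i] below [j.+1], [e j.+1] divides [a i]. For [i = j.+1], the equation trades the term for
   the other ones: those of smaller index are multiples of [e j.+1], those of larger index
   vanish. *)
move: ij; rewrite ltnS leq_eqVlt => /predU1P[ij|ij]; last first.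
  by rewrite mulrC; apply/divides_mull/e_div.
have -> : i = lift ord0 j by apply: ord_inj; rewrite lift0.
move: ax; rewrite /solution (bigD1 (lift ord0 j)) //=.
move/eqP; rewrite addr_eq0 => /eqP ->; rewrite -sumrN.
apply: divides_sum => h hj; rewrite -mulrN mulrC; case: (ltnP h j.+1) => hj1.
  exact/divides_mull/e_div.
rewrite x0; first by exists 0; rewrite oppr0 !mul0r.
by rewrite ltn_neqAle hj1 andbT eq_sym -(lift0 j).
Qed.
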